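(* Let $\boldsymbol V=(V_t)_{t\in[0,1]}$ be a standard generalized Pareto process with generator process $\boldsymbol Z=(Z_t)_{t\in[0,1]}$. Let $\mathcal G_d=\{s_0^{(d)},\dots,s_d^{(d)}\}$, $0=s_0^{(d)}<\dots<s_d^{(d)}=1$, $d\in\mathbb{N}$, be a sequence of grids in $[0,1]$ with diameter $\max_{i=1,\dots,d}(s_i^{(d)}-s_{i-1}^{(d)})\to0$ as $d\to\infty$. Let $\hat{\boldsymbol V}^{(d)}$ be the discretized version of $\boldsymbol V$ with grid $\mathcal G_d$, and $\hat{\boldsymbol Z}^{(d)}$ its generator process. For $t\in[0,1]$ and $d\in\mathbb{N}$ let $\|\cdot\|_{D_t^{(d)}}$ be the $D$-norm on $\mathbb{R}^2$ generated by $(Z_t,\hat Z_t^{(d)})$. Let $t\in[0,1]$ and suppose $\|\cdot\|_{D_t^{(d)}}\ne\|\cdot\|_1$ for all $d\in\mathbb{N}$. Then we have for $c<0$ close enough to zero $$E\Bigl(\bigl(V_t-\hat V_t^{(d)}\bigr)^2\,\Big|\,V_t>c,\ \hat V_t^{(d)}>c\Bigr)\to_{d\to\infty}0.$$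
   Context: $\bar C^+[0,1]$ and $\bar C^-[0,1]$ are the nonnegative and nonpositive functions in $C[0,1]$. $E[0,1]$ is the set of bounded functions $f:[0,1]\to\mathbb{R}$ with only finitely many discontinuities, $\bar E^-[0,1]=\{f\in E[0,1]:f\le0\}$, and $\|\cdot\|_\infty$ is the sup-norm. On $\mathbb{R}^2$, $\|(x,y)\|_1=|x|+|y|$. The $D$-norm on $\mathbb{R}^2$ generated by $(Z_1,Z_2)$ (with $0\le Z_i\le c$ a.s. for some constant $c\ge 1$, $E(Z_i)=1$) is $\|(x,y)\|_D=E(\max(|x|Z_1,|y|Z_2))$. Generator process: a process $\boldsymbol Z=(Z_t)_{t\in[0,1]}$ with sample paths in $\bar C^+[0,1]$, bounded a.s. by some constant, with $E(Z_t)=1$ for all $t$; it generates the $D$-norm $\|f\|_D=E(\sup_{t\in[0,1]}|f(t)|Z_t)$ on $E[0,1]$. Standard generalized Pareto process (SGPP): a process $\boldsymbol V$ with sample paths in $\bar C^-[0,1]$ for which there are a $D$-norm $\|\cdot\|_D$ on $E[0,1]$ and some $c_0>0$ with $P(\boldsymbol V\le f)=1-\|f\|_D$ for all $f\in\bar E^-[0,1]$ with $\|f\|_\infty\le c_0$. A generator process of $\boldsymbol V$ is a generator process of this $D$-norm. Discretized version: for a grid $0=s_0<s_1<\dots<s_d=1$ put $\|(x,y)\|_{D_{i-1,i}}=E(\max(|x|Z_{s_{i-1}},|y|Z_{s_i}))$ and, for $t\in[s_{i-1},s_i]$, $i=1,\dots,d$, $$\hat V_t=\|(s_i-t,t-s_{i-1})\|_{D_{i-1,i}}\max\left(\frac{V_{s_{i-1}}}{s_i-t},\frac{V_{s_i}}{t-s_{i-1}}\right),\qquad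 \hat Z_t=\frac{\max\bigl((s_i-t)Z_{s_{i-1}},(t-s_{i-1})Z_{s_i}\bigr)}{\|(s_i-t,t-s_{i-1})\|_{D_{i-1,i}}}.$$ Then $\hat{\boldsymbol V}=(\hat V_t)$ is the discretized version of $\boldsymbol V$ with this grid; it is an SGPP with generator process $\hat{\boldsymbol Z}=(\hat Z_t)$. Convention: $V_{s_i}<0$ a.s., and $x/0:=-\infty$ for $x<0$. *)

(* Defs.v *)
From HB Require Import structures.
From mathcomp Require Import all_boot all_order all_algebra.
From mathcomp Require Import all_classical all_reals all_analysis.
From mathcomp Require Import measurable_realfun.
Set Implicit Arguments.
Unset Strict Implicit.
Unset Printing Implicit Defensive.
Import Order.TTheory GRing.Theory Num.Theory.
Import numFieldNormedType.Exports.
Local Open Scope classical_set_scope.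
Local Open Scope ereal_scope.
Local Open Scope ring_scope.

(* Functions on [0,1] and processes indexed by [0,1] are represented by
   functions of a real parameter; values outside [0,1] are never used. *)

Section FunctionSpace.
Context {R : realType}.
Implicit Types f : R -> R.

Definition supnorm f : R := sup [set `|f t| | t in `[0, 1]].

(* E[0,1]; continuity is relative to [0,1], hence the subspace topology. *)
Definition in_E01 f : Prop :=
  (exists M : R, forall t, t \in `[0, 1] -> `|f t| <= M) /\
  finite_set [set t | t \in `[0, 1] /\
                      ~ {for t, continuous (f : subspace `[0, 1] -> R)}].

Definition in_E01_nonpos f : Prop :=
  in_E01 f /\ forall t, t \in `[0, 1] -> f t <= 0.

Definition norm1 (x y : R) : R := `|x| + `|y|.

End FunctionSpace.

Section Processes.
Context {R : realType} {d : measure_display} {T : measurableType d}.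
Variable P : probability T R.
Implicit Types (X Z V : R -> T -> R).

Definition continuous_process X : Prop :=
  (forall t, t \in `[0, 1] -> measurable_fun setT (X t)) /\
  (forall w, {within `[0, 1], continuous (fun t => X t w)}).

Definition generator_process Z : Prop :=
  [/\ continuous_process Z,
      forall t w, t \in `[0, 1] -> 0 <= Z t w,
      exists M : R, {ae P, forall w, forall t, t \in `[0, 1] -> Z t w <= M} &
      forall t, t \in `[0, 1] -> 'E_P[Z t] = 1%E].

Definition dnorm Z (f : R -> R) : R :=
  fine 'E_P[fun w => sup [set `|f t| * Z t w | t in `[0, 1]]].

Definition dnorm2 (Z1 Z2 : T -> R) (x y : R) : R :=
  fine 'E_P[fun w => Num.max (`|x| * Z1 w) (`|y| * Z2 w)].

(* E(Y | A) for an event A; meaningful only if P(A) > 0. *)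
Definition cond_expectation (Y : T -> R) (A : set T) : R :=
  fine (\int[P]_(w in A) (Y w)%:E) / fine (P A).

End Processes.

(* V and its generator process Z may live on different probability spaces:
   Z enters only through the D-norm it generates. *)
Definition sgpp_with_generator {R : realType}
    {d d' : measure_display} {T : measurableType d} {T' : measurableType d'}
    (P : probability T R) (P' : probability T' R)
    (V : R -> T -> R) (Z : R -> T' -> R) : Prop :=
  [/\ continuous_process V,
      forall t w, t \in `[0, 1] -> V t w <= 0,
      generator_process P' Z &
      exists c0 : R, 0 < c0 /\
        forall f, in_E01_nonpos f -> supnorm f <= c0 ->
          P [set w | forall t, t \in `[0, 1] -> V t w <= f t]
            = (1 - dnorm P' Z f)%:E].

Section Discretization.
Context {R : realType}.

(* A grid with d cells is given by the values s 0, ..., s d. *)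
Definition is_grid (d : nat) (s : nat -> R) : Prop :=
  [/\ s 0%N = 0, s d = 1 & forall i, (i < d)%N -> s i < s i.+1].

Definition diameter (d : nat) (s : nat -> R) : R :=
  \big[Num.max/0]_(i < d) (s i.+1 - s i).

(* The quotient x / a for x <= 0 <= a, with x / 0 := -oo. *)
Definition div_ninfty (x a : R) : \bar R :=
  if a == 0 then -oo%E else (x / a)%:E.

(* The least i with t <= s i.+1.  A grid point belongs to two cells; either
   choice gives the same value (lemmas disc_V_cell and disc_Z_cell). *)
Definition cell (d : nat) (s : nat -> R) (t : R) : nat :=
  find (fun i => t <= s i.+1) (iota 0 d).

Context {dT dT' : measure_display}.
Context {T : measurableType dT} {T' : measurableType dT'}.
Variables (P' : probability T' R).
Implicit Types (V : R -> T -> R) (Z : R -> T' -> R).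

Definition disc_V_on Z V (s : nat -> R) (i : nat) (t : R) (w : T) : R :=
  dnorm2 P' (Z (s i)) (Z (s i.+1)) (s i.+1 - t) (t - s i) *
  fine (maxe (div_ninfty (V (s i) w) (s i.+1 - t))
             (div_ninfty (V (s i.+1) w) (t - s i))).

Definition disc_Z_on Z (s : nat -> R) (i : nat) (t : R) (w : T') : R :=
  Num.max ((s i.+1 - t) * Z (s i) w) ((t - s i) * Z (s i.+1) w) /
  dnorm2 P' (Z (s i)) (Z (s i.+1)) (s i.+1 - t) (t - s i).

Definition disc_V Z V (d : nat) (s : nat -> R) (t : R) : T -> R :=
  disc_V_on Z V s (cell d s t) t.

Definition disc_Z Z (d : nat) (s : nat -> R) (t : R) : T' -> R :=
  disc_Z_on Z s (cell d s t) t.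

Lemma grid_le (d : nat) (s : nat -> R) i j :
  is_grid d s -> (i <= j <= d)%N -> s i <= s j.
Proof.
move=> [_ _ lts] /andP[]; elim: j => [|j IH]; first by rewrite leqn0 => /eqP->.
rewrite leq_eqVlt => /orP[/eqP-> //|ij] jd.
by apply: (le_trans (IH ij (ltnW jd))); apply: ltW; apply: lts.
Qed.

Lemma grid01 (d : nat) (s : nat -> R) i :
  is_grid d s -> (i <= d)%N -> s i \in `[0, 1].
Proof.
move=> gs id; have [s0 sd _] := gs; rewrite in_itv/= -{1}s0 -sd.
by rewrite !(grid_le gs) ?id ?leqnn.
Qed.

(* Uniqueness of the cell up to the case of a common end point. *)
Lemma cellP (d : nat) (s : nat -> R) i t :
  is_grid d s -> (i < d)%N -> s i <= t <= s i.+1 ->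
  cell d s t = i \/ (i = (cell d s t).+1 /\ t = s i).
Proof.
move=> gs id /andP[sit tsi]; have [_ _ lts] := gs; rewrite /cell.
set p := fun i => t <= s i.+1.
have hp : has p (iota 0 d) by apply/hasP; exists i; rewrite ?mem_iota.
have cd : (find p (iota 0 d) < d)%N by move: hp; rewrite has_find size_iota.
have := nth_find 0%N hp; rewrite nth_iota// add0n.
set j := find _ _ in cd * => pj.
have ji : (j <= i)%N.
  rewrite leqNgt; apply/negP => ij; have := before_find 0%N ij.
  by rewrite nth_iota// add0n /p tsi.
move: ji; rewrite leq_eqVlt => /orP[/eqP ji|ji]; first by left.
right; have e1 : s j.+1 <= s i by apply: (grid_le gs); rewrite ji ltnW.
have ts : t = s i by apply/eqP; rewrite eq_le sit (le_trans pj).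
split=> //; apply/eqP; rewrite eqn_leq ji andbT leqNgt; apply/negP => ij.
have : s j.+1 < s i.
  apply: (lt_le_trans (lts j.+1 (ltn_trans ij id))).
  by apply: (grid_le gs); rewrite ij ltnW.
by rewrite -ts ltNge (pj : t <= s j.+1).
Qed.

Lemma dnorm2_0l (Z1 Z2 : T' -> R) b : measurable_fun setT Z2 ->
  (forall w, 0 <= Z2 w) -> 'E_P'[Z2] = 1%E -> 0 <= b ->
  dnorm2 P' Z1 Z2 0 b = b.
Proof.
move=> mZ Z0 EZ b0; rewrite /dnorm2 unlock.
under eq_integral do
  rewrite normr0 mul0r (ger0_norm b0) (max_idPr (mulr_ge0 b0 (Z0 _))) EFinM.
rewrite ge0_integralZl//; first by move: EZ; rewrite unlock => ->; rewrite mule1.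
- exact/measurable_EFinP.
- by move=> w _; rewrite lee_fin.
Qed.

Lemma dnorm2_0r (Z1 Z2 : T' -> R) a : measurable_fun setT Z1 ->
  (forall w, 0 <= Z1 w) -> 'E_P'[Z1] = 1%E -> 0 <= a ->
  dnorm2 P' Z1 Z2 a 0 = a.
Proof.
move=> mZ Z0 EZ a0; rewrite -[RHS](dnorm2_0l Z2 mZ Z0 EZ a0) /dnorm2.
by congr (fine 'E_P'[_]); apply/funext => w; rewrite maxC.
Qed.

Lemma disc_V_cell Z V (d : nat) (s : nat -> R) i t w :
  generator_process P' Z -> is_grid d s -> (i < d)%N -> s i <= t <= s i.+1 ->
  disc_V Z V d s t w = disc_V_on Z V s i t w.
Proof.
move=> [[mZ _] Z0 _ EZ] gs id ist; rewrite /disc_V.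
have [-> //|[ij ts]] := cellP gs id ist.
move: ij; move: (cell d s t) => j ij; have [_ _ lts] := gs.
have jd : (j < d)%N by rewrite (leq_trans _ (ltnW id))// ij.
have i01 := grid01 gs (ltnW id).
have lj := lts _ jd; rewrite -ij in lj; have li := lts _ id.
have a0 : 0 < s i.+1 - s i by rewrite subr_gt0.
have b0 : 0 < s i - s j by rewrite subr_gt0.
rewrite /disc_V_on -ij ts !subrr dnorm2_0l ?dnorm2_0r ?ltW//;
  try by [apply: mZ | move=> ?; apply: Z0 | apply: EZ].
rewrite /div_ninfty eqxx (gt_eqF a0) (gt_eqF b0) maxNye maxeNy /=.
by rewrite ![_ * (_ / _)]mulrC !mulfVK ?gt_eqF.
Qed.

Lemma disc_Z_cell Z (d : nat) (s : nat -> R) i t w :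
  generator_process P' Z -> is_grid d s -> (i < d)%N -> s i <= t <= s i.+1 ->
  disc_Z Z d s t w = disc_Z_on Z s i t w.
Proof.
move=> [[mZ _] Z0 _ EZ] gs id ist; rewrite /disc_Z.
have [-> //|[ij ts]] := cellP gs id ist.
move: ij; move: (cell d s t) => j ij; have [_ _ lts] := gs.
have jd : (j < d)%N by rewrite (leq_trans _ (ltnW id))// ij.
have i01 := grid01 gs (ltnW id).
have lj := lts _ jd; rewrite -ij in lj; have li := lts _ id.
have a0 : 0 < s i.+1 - s i by rewrite subr_gt0.
have b0 : 0 < s i - s j by rewrite subr_gt0.
rewrite /disc_Z_on -ij ts !subrr dnorm2_0l ?dnorm2_0r ?ltW//;
  try by [apply: mZ | move=> ?; apply: Z0 | apply: EZ].
have Zi : 0 <= Z (s i) w by apply: Z0.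
rewrite !mul0r (max_idPr (mulr_ge0 (ltW b0) Zi)).
rewrite (max_idPl (mulr_ge0 (ltW a0) Zi)).
by rewrite !(mulrC _ (Z _ _)) !mulfK ?gt_eqF.
Qed.

End Discretization.

(* Main.v *)
(* For functions [f] supported on the at most three points [t], [a], [b] (the
   ends of the cell containing [t]), [P (V <= f)] is explicit; inclusion and
   exclusion turn this into [P (A d) = |c| (2 - E max (Z_t, hatZ_t))].  This is
   positive: otherwise [min (Z_t, hatZ_t)] has mean zero and the D-norm of
   [(Z_t, hatZ_t)] is the 1-norm.  Let [h] be the larger of the weights [b - t]
   and [t - a], and [e = E max (|Z_a - Z_t|, |Z_b - Z_t|)].  The norm of the
   weights lies between [h] and [h (1 + e)], so [hatV_t] differs from [V_t] by
   at most [(1 + e) max (|V_a - V_t|, |V_b - V_t|) + e |V_t|], and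
   [E max (Z_t, hatZ_t) <= 1 + e].  By continuity of the paths and dominated
   convergence [e -> 0]; the probabilities [P (A d)] are then eventually at
   least [|c| / 2], and the squared error, bounded by [c ^ 2] on [A d], has
   integral tending to zero. *)
Require Import Defs.
From mathcomp Require Import all_boot all_order all_algebra.
From mathcomp Require Import all_classical all_reals all_analysis.
From mathcomp Require Import measurable_realfun ring lra.
Set Implicit Arguments.
Unset Strict Implicit.
Unset Printing Implicit Defensive.
Import Order.TTheory GRing.Theory Num.Theory.
Import numFieldNormedType.Exports.
Local Open Scope classical_set_scope.
Local Open Scope ring_scope.

(** * Dominated convergence and elementary bounds for maxima *)

(** Dominated convergence with the constant [M] as majorant, integrable because [mu] is a
    probability. It serves both the mean oscillation of [Z] and the squared error. *)
Lemma Rintegral_bounded_cvg0 d (T : measurableType d) (R : realType)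
    (mu : probability T R) (f : nat -> T -> R) (M : R) :
  (forall n, measurable_fun setT (f n)) ->
  (forall w, f n w @[n --> \oo] --> (0 : R)) ->
  {ae mu, forall w, forall n, `|f n w| <= M} ->
  \int[mu]_w f n w @[n --> \oo] --> (0 : R).
Proof.
move=> mf f0 fM.
have [|||||_ _ +] := @dominated_convergence _ _ _ mu setT measurableT
  (fun n w => (f n w)%:E) (cst 0%E) (cst M%:E).
- by move=> n; exact/measurable_EFinP.
- by [].
- by apply: aeW => w _; apply: cvg_EFin; [exact: nearW|exact: f0].
- exact: finite_measure_integrable_cst.
- by apply: filterS fM => w h n _; rewrite lee_fin.
- by rewrite /= integral0 => /fine_cvg.
Qed.

Lemma integrable_maxr d (T : measurableType d) (R : realType)
    (mu : {measure set T -> \bar R}) (f g : T -> R) :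
  mu.-integrable setT (EFin \o f) -> mu.-integrable setT (EFin \o g) ->
  mu.-integrable setT (EFin \o (f \max g)).
Proof.
move=> fi gi; have /= fgi := integrableD measurableT
  (integrable_norm fi) (integrable_norm gi).
apply: le_integrable fgi => //=.
  apply/measurable_EFinP; apply: measurable_maxr; apply/measurable_EFinP.
  - exact: measurable_int fi.
  - exact: measurable_int gi.
move=> w _; rewrite lee_fin [leRHS]ger0_norm ?addr_ge0//.
by case: (leP (f w) (g w)) => _; rewrite ?lerDl ?lerDr.
Qed.

Lemma normr_max_sub_le (R : realDomainType) (a b a' b' : R) :
  `|Num.max a b - Num.max a' b'| <= Num.max `|a - a'| `|b - b'|.
Proof.
rewrite ler_norml; set m := Num.max `|_| `|_|.
have /andP[am am'] : - m <= a - a' <= m by rewrite -ler_norml le_max lexx.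
have /andP[bm bm'] : - m <= b - b' <= m.
  by rewrite -ler_norml le_max lexx orbT.
by case: (leP a b); case: (leP a' b'); lra.
Qed.

(** Since [z >= 0], [max p q * z] is [max (p * z) (q * z)], and the maximum is nonexpansive. *)
Lemma normr_max_mul_sub_le (R : realDomainType) (p q x y z : R) :
  0 <= p -> 0 <= q -> 0 <= z ->
  `|Num.max (p * x) (q * y) - Num.max p q * z|
    <= Num.max p q * Num.max `|x - z| `|y - z|.
Proof.
move=> p0 q0 z0; rewrite maxr_pMl//.
apply: le_trans (normr_max_sub_le _ _ _ _) _.
rewrite -!mulrBr !normrM (ger0_norm p0) (ger0_norm q0).
by rewrite ge_max !ler_pM// ?le_max ?lexx ?orbT.
Qed.

(* The two-point maximum of [disc_V]: as [x, y <= 0], the entry with the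
   smaller weight can only raise the maximum towards [0], never above its
   value with the larger weight. *)
Lemma normr_max_div_ninfty_sub_le (R : realType) (p q x y v : R) :
  0 <= p -> 0 <= q -> 0 < p + q -> x <= 0 -> y <= 0 ->
  `|Num.max p q * fine (maxe (div_ninfty x p) (div_ninfty y q)) - v|
    <= Num.max `|x - v| `|y - v|.
Proof.
wlog pq : p q x y / q <= p => [hw|] p0 q0 pq0 x0 y0.
  case/orP: (le_total q p) => [qp|pq]; first exact: hw.
  by rewrite (maxC p) (maxC `|x - v|) (maxC (div_ninfty x p)); apply: hw; rewrite // addrC.
have pgt0 : 0 < p by lra.
rewrite (max_idPl pq) {1}/div_ninfty gt_eqF//.
set m := Num.max `|_| `|_|; rewrite ler_norml.
have /andP[xm xm'] : - m <= x - v <= m by rewrite -ler_norml le_max lexx.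
have /andP[ym ym'] : - m <= y - v <= m.
  by rewrite -ler_norml le_max lexx orbT.
rewrite /div_ninfty; case: eqVneq => [_|qn0].
  by rewrite maxeNy /= mulrC divfK ?gt_eqF// xm.
have qgt0 : 0 < q by rewrite lt_def qn0.
rewrite -EFin_max /= maxr_pMr// mulrC divfK ?gt_eqF//.
have yp : p * (y / q) <= y by rewrite mulrA ler_pdivrMr//; nra.
by case: (leP x (p * (y / q))) => h; apply/andP; split; lra.
Qed.

(** A zero weight makes its quotient [-oo], which drops out of the maximum; the matching condition
    on the right then reads [x <= 0] or [y <= 0] and holds. *)
Lemma fine_max_div_ninfty_le (R : realType) (p q x y N c : R) :
  0 <= p -> 0 <= q -> 0 < p + q -> 0 < N -> x <= 0 -> y <= 0 ->
  (N * fine (maxe (div_ninfty x p) (div_ninfty y q)) <= c) =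
  (x <= c * p / N) && (y <= c * q / N).
Proof.
move=> p0 q0 pq0 N0 x0 y0.
have div (a b : R) : 0 < b -> (a <= c * b / N) = (N * (a / b) <= c).
  by move=> b0; rewrite ler_pdivlMr// mulrA ler_pdivrMr// [N * a]mulrC.
rewrite /div_ninfty; case: eqVneq => [p00|pn0]; case: eqVneq => [q00|qn0].
- by move: pq0; rewrite p00 q00 addr0 ltxx.
- rewrite maxNye/= p00 mulr0 mul0r x0/= div//.
  by rewrite lt_def qn0.
- rewrite maxeNy/= q00 mulr0 mul0r y0 andbT div//.
  by rewrite lt_def pn0.
- rewrite -EFin_max/= !div ?lt_def ?pn0 ?qn0//.
  by rewrite (maxr_pMr _ _ (ltW N0)) ge_max.
Qed.

(** Paths are continuous relative to [[0, 1]], so the sequence has to stay inside. *)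
Lemma continuous_process_cvg (R : realType) d (T : measurableType d)
    (X : R -> T -> R) (u : nat -> R) (t : R) (w : T) :
  continuous_process X -> t \in `[0, 1] -> (forall n, u n \in `[0, 1]) ->
  u n @[n --> \oo] --> t -> X (u n) w @[n --> \oo] --> X t w.
Proof.
move=> [_ cX] t01 u01 ut B /= XB.
have [+ _] := @subspace_continuousP R `[0, 1] R (fun t => X t w).
move=> /(_ (cX w) _ t01 _ XB) wB.
have h : \forall n \near \oo, `[0, 1]%classic (u n) -> B (X (u n) w).
  exact: ut _ wB.
by rewrite !near_simpl; near=> n; apply: (near h n) => //; exact: u01.
Unshelve. all: end_near. Qed.

(** * Joint law of [V] at three points *)

Lemma sup_attained (R : realType) (A : set R) (m x : R) :
  ubound A m -> A x -> m <= x -> sup A = m.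
Proof.
move=> Am Ax mx; apply/eqP; rewrite eq_le ge_sup//; last by exists x.
by apply: (le_trans mx); apply: ub_le_sup => //; exists m.
Qed.

(** For [x <= 0], the bound [V <= spike p x] constrains a nonpositive process at [p] only. Minima of
    spikes thus isolate finitely many points. *)
Definition spike (R : realType) (p x u : R) : R := if u == p then x else 0.

Lemma spike_continuous (R : realType) (p x u : R) :
  u != p -> {for u, continuous (spike p x)}.
Proof.
move=> up; rewrite /prop_for /continuous_at {2}/spike (negbTE up).
apply: cvg_near_cst.
have : \forall v \near u, v != p.
  by apply: open_nbhs_nbhs; split; [exact: open_neq|].
by apply: filterS => v vp; rewrite /spike (negbTE vp).
Qed.

Lemma spikes_in_E01 (R : realType) (p q r x y z c : R) :
  - c <= x <= 0 -> - c <= y <= 0 -> - c <= z <= 0 ->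
  let f := spike p x \min (spike q y \min spike r z) in
  in_E01_nonpos f /\ supnorm f <= c.
Proof.
move=> hx hy hz f.
have fc u : - c <= f u <= 0.
  rewrite /f /= /spike le_min !ge_min !le_min.
  by do !case: eqVneq => _; lra.
have nf u : `|f u| <= c by rewrite ler_norml; have := fc u; lra.
split; last first.
  apply: ge_sup; first by exists `|f 0|, 0; rewrite //= in_itv/= lexx ler01.
  by move=> _ [u _ <-].
split; last by move=> u _; case/andP: (fc u).
split; first by exists c.
apply: (@sub_finite_set _ _ ([set p] `|` ([set q] `|` [set r]))); last first.
  by rewrite !finite_setU; do !split.
move=> u /= [u01]; apply: contra_notP => /not_orP[/eqP up /not_orP[/eqP uq /eqP ur]].
apply: continuous_subspaceT_for => //.
by do !apply: continuous_min; exact: spike_continuous.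
Qed.

(** The test function is a minimum of three spikes: off [p], [q], [r] it vanishes, and [V <= 0]
    holds anyway. The points may coincide, so the formula also covers one or two points. *)
Lemma sgpp_cdf3 (R : realType) (d d' : measure_display)
    (T : measurableType d) (T' : measurableType d')
    (P : probability T R) (P' : probability T' R)
    (V : R -> T -> R) (Z : R -> T' -> R) :
  sgpp_with_generator P P' V Z ->
  exists c0 : R, 0 < c0 /\ forall p q r x y z : R,
    p \in `[0, 1] -> q \in `[0, 1] -> r \in `[0, 1] ->
    - c0 <= x <= 0 -> - c0 <= y <= 0 -> - c0 <= z <= 0 ->
    P [set w | [/\ V p w <= x, V q w <= y & V r w <= z]] =
    (1 - \int[P']_w Num.max (- x * Z p w)
                            (Num.max (- y * Z q w) (- z * Z r w)))%:E.
Proof.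
move=> [_ V0 [_ Z0 _ _] [c0 [c0_gt0 cdf]]]; exists c0; split => //.
move=> p q r x y z p01 q01 r01 hx hy hz.
have [fE fc] := spikes_in_E01 p q r hx hy hz.
set f := _ \min _ in fE fc.
have fle u : [/\ f u <= spike p x u, f u <= spike q y u & f u <= spike r z u].
  by rewrite /f /= !ge_min !lexx !orbT.
have [fp fq fr] : [/\ f p <= x, f q <= y & f r <= z].
  split; [have [+ _ _] := fle p|have [_ + _] := fle q|have [_ _ +] := fle r];
    by rewrite /spike eqxx.
transitivity (P [set w | forall u, u \in `[0, 1] -> V u w <= f u]).
  congr (P _); apply/seteqP; split => w /=.
    move=> [Vx Vy Vz] u u01; rewrite /f /= !le_min /spike.
    by apply/and3P; split; case: eqVneq => [->|_] //; exact: V0.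
  by move=> Vf; split; [move: fp|move: fq|move: fr]; apply: le_trans; exact: Vf.
rewrite cdf// /dnorm unlock; congr (1 - fine _)%:E.
apply: eq_integral => w _; congr EFin.
set m := Num.max _ _.
have m0 : 0 <= m.
  by rewrite le_max mulr_ge0 ?Z0// oppr_ge0; case/andP: hx.
have fN u : u \in `[0, 1] -> `|f u| = - f u.
  by move=> u01; rewrite ler0_norm//; case: fE => _; exact.
have ub : ubound [set `|f u| * Z u w | u in `[0, 1]] m.
  move=> _ [u u01 <-]; rewrite fN// /f /= !oppr_min.
  have zu := Z0 u w u01; rewrite !maxr_pMl// !ge_max /spike.
  by apply/and3P; split; case: eqVneq => [->|_];
    rewrite ?oppr0 ?mul0r// /m !le_max lexx ?orbT.
(* Coinciding points may push [f u] below [x'], so only an inequality is available; with the upper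
   bound [m] it still makes the supremum equal to [m]. *)
have lb u x' : u \in `[0, 1] -> f u <= x' -> - x' * Z u w = m -> 
    sup [set `|f u| * Z u w | u in `[0, 1]] = m.
  move=> u01 fx xm; apply: (sup_attained ub); first by exists u.
  by rewrite -xm ler_wpM2r ?Z0// fN// lerN2.
have : [\/ - x * Z p w = m, - y * Z q w = m | - z * Z r w = m].
  rewrite /m; case: (leP (- x * Z p w)) => _; last by apply: Or31.
  by case: (leP (- y * Z q w)) => _; [apply: Or33|apply: Or32].
by case=> [/(lb p x p01 fp)|/(lb q y q01 fq)|/(lb r z r01 fr)].
Qed.

(** * Grid cells and oscillation at their ends *)

Lemma cell_bounds (R : realType) (d : nat) (s : nat -> R) (t : R) :
  is_grid d s -> (0 < d)%N -> t \in `[0, 1] ->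
  (cell d s t < d)%N /\ s (cell d s t) <= t <= s (cell d s t).+1.
Proof.
move=> [s0 sd _] d0; rewrite in_itv/= => /andP[t0 t1]; rewrite /cell.
set p := fun i => t <= s i.+1.
have hp : has p (iota 0 d).
  apply/hasP; exists d.-1; first by rewrite mem_iota add0n prednK/=.
  by rewrite /p prednK// sd.
have cd : (find p (iota 0 d) < d)%N by move: hp; rewrite has_find size_iota.
split=> //; have := nth_find 0%N hp; rewrite nth_iota// add0n => pf.
apply/andP; split; last exact: pf.
(* A positive index means that [find] rejected the preceding cell, whose right end, the left end of
   this one, therefore lies below [t]. *)
case E : (find p (iota 0 d)) => [|j]; first by rewrite s0.
have := @before_find _ 0%N p (iota 0 d) j; rewrite E => /(_ (ltnSn j)).
by rewrite nth_iota ?add0n ?(ltn_trans _ cd) ?E// /p => /negbT; rewrite -ltNge => /ltW.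
Qed.

Lemma cell_le_diameter (R : realType) (d : nat) (s : nat -> R) (i : nat) :
  (i < d)%N -> s i.+1 - s i <= diameter d s.
Proof. by move=> id; exact: (le_bigmax _ (fun j : 'I_d => s j.+1 - s j) (Ordinal id)). Qed.

(** Only two points enter, not a supremum over an interval: the discretized processes see a path
    just through the ends of the cell. *)
Definition oscillation (R : realType) (T : Type) (X : R -> T -> R)
    (u v t : R) (w : T) : R :=
  Num.max `|X u w - X t w| `|X v w - X t w|.

Lemma oscillation_cvg0 (R : realType) d (T : measurableType d)
    (X : R -> T -> R) (u v : nat -> R) (t : R) (w : T) :
  continuous_process X ->
  (forall n, u n \in `[0, 1]) -> (forall n, v n \in `[0, 1]) ->
  t \in `[0, 1] -> u n @[n --> \oo] --> t -> v n @[n --> \oo] --> t ->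
  oscillation X (u n) (v n) t w @[n --> \oo] --> (0 : R).
Proof.
move=> cX u01 v01 t01 ut vt.
have dist (x : nat -> R) : (forall n, x n \in `[0, 1]) ->
    x n @[n --> \oo] --> t -> `|X (x n) w - X t w| @[n --> \oo] --> (0 : R).
  move=> x01 xt; rewrite -(@normr0 R R) -(subrr (X t w)).
  apply: cvg_norm; apply: cvgB; last exact: cvg_cst.
  exact: continuous_process_cvg.
have sum0 : `|X (u n) w - X t w| + `|X (v n) w - X t w|
    @[n --> \oo] --> (0 : R).
  by rewrite -[0 in X in _ --> X](addr0 0); apply: cvgD; exact: dist.
apply: (squeeze_cvgr _ (cvg_cst 0) sum0); apply: nearW => n.
by rewrite le_max normr_ge0 ge_max lerDl lerDr !normr_ge0.
Qed.

(** * Integrals of the generator and bounds for its bivariate D-norms *)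

Section GeneratorProcess.
Context {R : realType} {d' : measure_display} {T' : measurableType d'}.
Context {P' : probability T' R} {Z : R -> T' -> R}.
Context (hZ : generator_process P' Z).

Lemma generator_integrable u : u \in `[0, 1] ->
  P'.-integrable setT (EFin \o Z u).
Proof.
have [[mZ _] Z0 _ EZ] := hZ => u01; apply/integrableP; split.
  by apply/measurable_EFinP; exact: mZ.
under eq_integral do rewrite /= ger0_norm ?Z0//.
by have := EZ _ u01; rewrite unlock => ->; rewrite ltry.
Qed.

Lemma generator_Rintegral u : u \in `[0, 1] -> \int[P']_w Z u w = 1.
Proof.
by have [_ _ _ EZ] := hZ => u01; have := EZ _ u01; rewrite unlock /Rintegral => ->.
Qed.

Lemma oscillation_integrable u v t :
  u \in `[0, 1] -> v \in `[0, 1] -> t \in `[0, 1] ->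
  P'.-integrable setT (EFin \o oscillation Z u v t).
Proof.
move=> u01 v01 t01.
have diff r : r \in `[0, 1] ->
    P'.-integrable setT (EFin \o (fun w => `|Z r w - Z t w|)).
  move=> r01; apply: (integrable_norm (f := fun w => Z r w - Z t w)).
  have := integrableB measurableT (generator_integrable r01)
    (generator_integrable t01).
  by [].
exact: integrable_maxr (diff _ u01) (diff _ v01).
Qed.

(** Almost surely all values of [Z] lie in [[0, M]], so that [M] also dominates the oscillation. *)
Lemma oscillation_Rintegral_cvg0 (u v : nat -> R) (t : R) :
  (forall n, u n \in `[0, 1]) -> (forall n, v n \in `[0, 1]) ->
  t \in `[0, 1] -> u n @[n --> \oo] --> t -> v n @[n --> \oo] --> t ->
  \int[P']_w oscillation Z (u n) (v n) t w @[n --> \oo] --> (0 : R).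
Proof.
move=> u01 v01 t01 ut vt; have [cZ Z0 [M ZM] _] := hZ.
apply: (@Rintegral_bounded_cvg0 _ _ _ _ _ M) => [n|w|].
- apply/measurable_EFinP; apply: measurable_int.
  exact: oscillation_integrable (u01 n) (v01 n) t01.
- exact: oscillation_cvg0.
- apply: filterS ZM => w wM n; rewrite /oscillation ger0_norm ?le_max ?normr_ge0//.
  have zt := Z0 t w t01; have zu := Z0 _ w (u01 n); have zv := Z0 _ w (v01 n).
  rewrite ge_max !ler_norml.
  have := wM t t01; have := wM _ (u01 n); have := wM _ (v01 n).
  by move=> *; apply/andP; split; apply/andP; split; lra.
Qed.

Lemma dnorm2_Rintegral u v p q : 0 <= p -> 0 <= q ->
  dnorm2 P' (Z u) (Z v) p q = \int[P']_w Num.max (p * Z u w) (q * Z v w).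
Proof.
by move=> p0 q0; rewrite /dnorm2 unlock (ger0_norm p0) (ger0_norm q0).
Qed.

Lemma scaled_integrable u p : u \in `[0, 1] ->
  P'.-integrable setT (EFin \o (fun w => p * Z u w)).
Proof.
move=> u01; have := integrableZl measurableT p (generator_integrable u01).
by [].
Qed.

Lemma scaled_max_integrable u v p q : u \in `[0, 1] -> v \in `[0, 1] ->
  P'.-integrable setT (EFin \o (fun w => Num.max (p * Z u w) (q * Z v w))).
Proof.
move=> u01 v01.
exact: integrable_maxr (scaled_integrable p u01) (scaled_integrable q v01).
Qed.

(** The two entries of the maximum have means [p] and [q]. *)
Lemma max_le_dnorm2 u v p q : u \in `[0, 1] -> v \in `[0, 1] ->
  0 <= p -> 0 <= q -> Num.max p q <= dnorm2 P' (Z u) (Z v) p q.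
Proof.
move=> u01 v01 p0 q0; rewrite dnorm2_Rintegral// ge_max.
have mi := scaled_max_integrable p q u01 v01.
apply/andP; split.
  rewrite -[leLHS]mulr1 -(generator_Rintegral u01) -RintegralZl//;
    last exact: generator_integrable.
  apply: le_Rintegral => //; first exact: scaled_integrable.
  by move=> w _; rewrite le_max lexx.
rewrite -[leLHS]mulr1 -(generator_Rintegral v01) -RintegralZl//;
  last exact: generator_integrable.
apply: le_Rintegral => //; first exact: scaled_integrable.
by move=> w _; rewrite le_max lexx orbT.
Qed.

(** Pointwise the integrand is at most [max p q] times [Z t] plus the oscillation, and [Z t] has
    mean 1. *)
Lemma dnorm2_le u v t p q :
  u \in `[0, 1] -> v \in `[0, 1] -> t \in `[0, 1] -> 0 <= p -> 0 <= q ->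
  dnorm2 P' (Z u) (Z v) p q <=
  Num.max p q * (1 + \int[P']_w oscillation Z u v t w).
Proof.
move=> u01 v01 t01 p0 q0; rewrite dnorm2_Rintegral//.
have zt := generator_integrable t01; have oi := oscillation_integrable u01 v01 t01.
rewrite -(generator_Rintegral t01) -RintegralD// -RintegralZl//; last first.
  by have := integrableD measurableT zt oi.
apply: le_Rintegral => //; first exact: scaled_max_integrable.
  by have := integrableZl measurableT (Num.max p q) (integrableD measurableT zt oi).
move=> w _; have [_ Z0 _ _] := hZ.
have := @normr_max_mul_sub_le _ _ _ (Z u w) (Z v w) _ p0 q0 (Z0 t w t01).
by rewrite -/(oscillation Z u v t w) ler_norml => /andP[_]; lra.
Qed.

End GeneratorProcess.

(** * The discretized processes at [t] in one fixed cell *)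

Section Cell.
Context {R : realType} {dT dT' : measure_display}.
Context {T : measurableType dT} {T' : measurableType dT'}.
Context {P : probability T R} {P' : probability T' R}.
Context {V : R -> T -> R} {Z : R -> T' -> R}.
Context (hZ : generator_process P' Z).
Context (cV : continuous_process V).
Context (V0 : forall u w, u \in `[0, 1] -> V u w <= 0).
Context (s : nat -> R) (i : nat) (t : R).
Context (a01 : s i \in `[0, 1]) (b01 : s i.+1 \in `[0, 1]).
Context (t01 : t \in `[0, 1]).
Context (ab : s i < s i.+1) (tab : s i <= t <= s i.+1).

(** [p] is the distance to the right end but the weight of the left one; for [q] it is the
    reverse. *)
Let p := s i.+1 - t.
Let q := t - s i.
Let N := dnorm2 P' (Z (s i)) (Z (s i.+1)) p q.
Let e := \int[P']_w oscillation Z (s i) (s i.+1) t w.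

Let p0 : 0 <= p. Proof. by rewrite subr_ge0; case/andP: tab. Qed.
Let q0 : 0 <= q. Proof. by rewrite subr_ge0; case/andP: tab. Qed.
Let pq0 : 0 < p + q. Proof. by rewrite addrA subrK subr_gt0. Qed.
Let h0 : 0 < Num.max p q.
Proof. by rewrite lt_max; have := pq0; case: ltP => //= p'; lra. Qed.
(** With [Ne] this confines [N / max p q] to the interval from 1 to [1 + e]. *)
Let hN : Num.max p q <= N. Proof. exact: max_le_dnorm2. Qed.
Let N0 : 0 < N. Proof. exact: lt_le_trans h0 hN. Qed.
Let Ne : N <= Num.max p q * (1 + e). Proof. exact: dnorm2_le. Qed.

Lemma disc_Z_integrable :
  P'.-integrable setT (EFin \o disc_Z_on P' Z s i t).
Proof.
have := integrableZr measurableT N^-1 (scaled_max_integrable hZ p q a01 b01).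
by [].
Qed.

(** [N] is exactly the integral of the numerator. *)
Lemma disc_Z_Rintegral : \int[P']_w disc_Z_on P' Z s i t w = 1.
Proof.
rewrite RintegralZr//; last exact: scaled_max_integrable.
by rewrite -dnorm2_Rintegral// divff// gt_eqF.
Qed.

Lemma max_disc_Z_integrable :
  P'.-integrable setT (EFin \o (fun w => Num.max (Z t w) (disc_Z_on P' Z s i t w))).
Proof.
exact: integrable_maxr (generator_integrable hZ t01) disc_Z_integrable.
Qed.

(** Pointwise the numerator of the discretized generator is at most [max p q], hence at most [N],
    times [Z t] plus the oscillation. *)
Lemma max_disc_Z_Rintegral_le :
  \int[P']_w Num.max (Z t w) (disc_Z_on P' Z s i t w) <= 1 + e.
Proof.
have zt := generator_integrable hZ t01.
have oi := oscillation_integrable hZ a01 b01 t01.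
rewrite -[X in _ <= X + _](generator_Rintegral hZ t01) -RintegralD//.
apply: le_Rintegral => //; first exact: max_disc_Z_integrable.
  by have := integrableD measurableT zt oi.
move=> w _; have [_ Z0 _ _] := hZ; have zt0 := Z0 t w t01.
have o0 : 0 <= oscillation Z (s i) (s i.+1) t w by rewrite le_max normr_ge0.
rewrite ge_max lerDl o0 /= ler_pdivrMr//.
apply: (le_trans _ (ler_wpM2l (addr_ge0 zt0 o0) hN)).
have := @normr_max_mul_sub_le _ _ _ (Z (s i) w) (Z (s i.+1) w) _ p0 q0 zt0.
rewrite -/(oscillation Z (s i) (s i.+1) t w) ler_norml => /andP[_].
by rewrite mulrDl -/p -/q; lra.
Qed.

Lemma disc_V_measurable : measurable_fun setT (disc_V_on P' Z V s i t).
Proof.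
have [mV _] := cV.
have mdiv (u x : R) : u \in `[0, 1] ->
    measurable_fun setT (fun w => div_ninfty (V u w) x).
  move=> u01; rewrite /div_ninfty; case: eqVneq => _ //.
  by apply/measurable_EFinP; apply: measurable_funM => //; exact: mV.
apply: measurable_funM => //; apply: measurableT_comp => //.
by apply: measurable_maxe; exact: mdiv.
Qed.

Lemma disc_V_le w c : (disc_V_on P' Z V s i t w <= c) =
  (V (s i) w <= c * p / N) && (V (s i.+1) w <= c * q / N).
Proof. by apply: fine_max_div_ninfty_le => //; exact: V0. Qed.

Lemma disc_V_le0 w : disc_V_on P' Z V s i t w <= 0.
Proof. by rewrite disc_V_le !mul0r !V0. Qed.

(** With [h = max p q] and [m] the maximum of the quotients, [h * m] is within the oscillation of
    [V t]. Replacing [h] by [N] multiplies this error by [N / h] and adds [(N / h - 1) * V t]. *)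
Lemma disc_V_near w : `|V t w - disc_V_on P' Z V s i t w| <=
  (1 + e) * oscillation V (s i) (s i.+1) t w + e * `|V t w|.
Proof.
rewrite distrC /disc_V_on -/p -/q -/N.
have := @normr_max_div_ninfty_sub_le _ _ _ _ _ (V t w) p0 q0 pq0
  (V0 w a01) (V0 w b01).
rewrite -/(oscillation V (s i) (s i.+1) t w).
set m := fine _; set o := oscillation _ _ _ _ _; set h := Num.max p q => hmo.
have r1 : 1 <= N / h by rewrite ler_pdivlMr// mul1r.
have re : N / h <= 1 + e by rewrite ler_pdivrMr// mulrC.
have -> : N * m - V t w = N / h * (h * m - V t w) + (N / h - 1) * V t w.
  by field; rewrite gt_eqF.
apply: (le_trans (ler_normD _ _)); rewrite (normrM (N / h)) (normrM (N / h - 1)).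
rewrite (ger0_norm (le_trans ler01 r1)) (@ger0_norm _ (N / h - 1)) ?subr_ge0//.
apply: lerD; first by apply: ler_pM => //; apply: le_trans ler01 r1.
by apply: ler_wpM2r => //; lra.
Qed.

(** Since [x / N] lies in [[0, 1]], the thresholds at the cell ends stay in the range where the law
    of [V] is known. *)
Lemma scaled_bound c0 c x : - c0 <= c <= 0 -> 0 <= x -> x <= Num.max p q ->
  - c0 <= c * x / N <= 0.
Proof.
move=> /andP[cc c_le0] x0 xh.
have xN : 0 <= x / N <= 1.
  by rewrite divr_ge0 ?(ltW N0)//= ler_pdivrMr// mul1r (le_trans xh).
by rewrite -mulrA; apply/andP; split; nra.
Qed.

(** Inclusion and exclusion for the complementary events [A] and [B]: each has probability [1 + c],
    and their intersection is an event about [V] at [t] and the two cell ends. *)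
Lemma sgpp_exceedance_prob (c0 c : R) :
  (forall p q r x y z : R,
    p \in `[0, 1] -> q \in `[0, 1] -> r \in `[0, 1] ->
    - c0 <= x <= 0 -> - c0 <= y <= 0 -> - c0 <= z <= 0 ->
    P [set w | [/\ V p w <= x, V q w <= y & V r w <= z]] =
    (1 - \int[P']_w Num.max (- x * Z p w)
                            (Num.max (- y * Z q w) (- z * Z r w)))%:E) ->
  - c0 <= c <= 0 ->
  P [set w | c < V t w /\ c < disc_V_on P' Z V s i t w] =
  (- c * (2 - \int[P']_w Num.max (Z t w) (disc_Z_on P' Z s i t w)))%:E.
Proof.
move=> cdf hc; have c_le0 : c <= 0 by case/andP: hc.
have nc0 : 0 <= - c by rewrite oppr_ge0.
set hV := disc_V_on P' Z V s i t; set hZt := disc_Z_on P' Z s i t.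
have hp : - c0 <= c * p / N <= 0 by apply: scaled_bound; rewrite ?le_max ?lexx.
have hq : - c0 <= c * q / N <= 0.
  by apply: scaled_bound; rewrite ?le_max ?lexx ?orbT.
(* The thresholds [c * p / N] and [c * q / N] turn the weighted maximum at the cell ends into a
   multiple of the discretized generator. *)
have maxZ w : Num.max (- (c * p / N) * Z (s i) w)
    (- (c * q / N) * Z (s i.+1) w) = - c * hZt w.
  rewrite /hZt /disc_Z_on -/p -/q -/N.
  rewrite mulrCA maxr_pMl ?divr_ge0 ?(ltW N0)//.
  by congr (Num.max _ _); ring.
pose A := [set w | V t w <= c]; pose B := [set w | hV w <= c].
have [mV _] := cV.
have mA : measurable A.
  have := mV t t01 measurableT _ (measurable_itv `]-oo, c]).
  by rewrite setTI /preimage; congr measurable; apply/seteqP; split => w /=; rewrite in_itv.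
have mB : measurable B.
  have := disc_V_measurable measurableT (measurable_itv `]-oo, c]).
  by rewrite setTI /preimage; congr measurable; apply/seteqP; split => w /=; rewrite in_itv.
have PA : P A = (1 + c)%:E.
  (* Repeating a point reduces the three-point law to fewer points. *)
  have -> : A = [set w | [/\ V t w <= c, V t w <= c & V t w <= c]].
    by apply/seteqP; split=> w //= -[].
  rewrite cdf//; under eq_Rintegral do rewrite !maxxx.
  rewrite RintegralZl//; last exact: generator_integrable.
  by rewrite (generator_Rintegral hZ)// mulr1 opprK.
have PB : P B = (1 + c)%:E.
  have -> : B = [set w | [/\ V (s i) w <= c * p / N,
      V (s i.+1) w <= c * q / N & V (s i.+1) w <= c * q / N]].
    apply/seteqP; split=> w /=; rewrite /B/= disc_V_le.
      by move=> /andP[].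
    by move=> [-> ->].
  rewrite cdf//; under eq_Rintegral do rewrite maxxx maxZ.
  rewrite RintegralZl//; last exact: disc_Z_integrable.
  by rewrite disc_Z_Rintegral mulr1 opprK.
have PAB : P (A `&` B) =
    (1 + c * \int[P']_w Num.max (Z t w) (hZt w))%:E.
  have -> : A `&` B = [set w | [/\ V t w <= c, V (s i) w <= c * p / N &
      V (s i.+1) w <= c * q / N]].
    apply/seteqP; split=> w /=; rewrite /A /B/= disc_V_le.
      by move=> [? /andP[]].
    by move=> [-> -> ->].
  rewrite cdf//; under eq_Rintegral do rewrite maxZ -maxr_pMr//.
  rewrite RintegralZl//; last exact: max_disc_Z_integrable.
  by rewrite mulNr opprK.
have -> : [set w | c < V t w /\ c < hV w] = ~` (A `|` B).
  rewrite setCU; apply/seteqP; split => w /=; rewrite /A /B /=.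
    by move=> [? ?]; rewrite !leNgt; split; apply/negP; rewrite negbK.
  by move=> [/negP + /negP]; rewrite -!ltNge.
rewrite probability_setC; last exact: measurableU.
have -> : P (A `|` B) = (P A + P B - P (A `&` B))%E.
  by apply: measureUfinr => //; rewrite ltey_eq fin_num_measure.
by rewrite PA PB PAB -!EFinD; congr EFin; ring.
Qed.

Lemma exceedance_measurable c :
  measurable [set w | c < V t w /\ c < disc_V_on P' Z V s i t w].
Proof.
have [mV _] := cV.
have lt_meas (f : T -> R) : measurable_fun setT f ->
    measurable [set w | c < f w].
  move=> mf; have := mf measurableT _ (measurable_itv `]c, +oo[).
  rewrite setTI /preimage; congr measurable.
  by apply/seteqP; split => w /=; rewrite in_itv/= andbT.
exact: measurableI (lt_meas _ (mV t t01)) (lt_meas _ disc_V_measurable).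
Qed.

Lemma disc_Z_ge0 w : 0 <= disc_Z_on P' Z s i t w.
Proof.
have [_ Z0 _ _] := hZ.
by rewrite divr_ge0 ?(ltW N0)// le_max mulr_ge0 ?p0// Z0.
Qed.

(** Both values lie between [c] and 0. *)
Lemma exceedance_sqr_le c w :
  c < V t w -> c < disc_V_on P' Z V s i t w ->
  (V t w - disc_V_on P' Z V s i t w) ^+ 2 <= c ^+ 2.
Proof.
have := V0 w t01; have := disc_V_le0 w.
by set v := disc_V_on _ _ _ _ _ _ _; move=> *; nra.
Qed.

End Cell.

(** * The case of the 1-norm *)

(** A maximum of nonnegative numbers is at most their sum. For the converse, [max (a f) (b g)] is at
    least [a f + b g - (a + b) min f g], where [min f g = f + g - max f g] has integral at most
    0. *)
Lemma dnorm2_norm1 (R : realType) d (T : measurableType d)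
    (mu : probability T R) (f g : T -> R) :
  (forall w, 0 <= f w) -> (forall w, 0 <= g w) ->
  mu.-integrable setT (EFin \o f) -> mu.-integrable setT (EFin \o g) ->
  \int[mu]_w f w = 1 -> \int[mu]_w g w = 1 ->
  2 <= \int[mu]_w Num.max (f w) (g w) -> dnorm2 mu f g = norm1.
Proof.
move=> f0 g0 fi gi f1 g1 max2; apply/funext => x; apply/funext => y.
have Zi k (u : T -> R) : mu.-integrable setT (EFin \o u) ->
    mu.-integrable setT (EFin \o (fun w => k * u w)).
  by move=> ui; have := integrableZl measurableT k ui.
have Di (u v : T -> R) : mu.-integrable setT (EFin \o u) ->
    mu.-integrable setT (EFin \o v) ->
    mu.-integrable setT (EFin \o (fun w => u w + v w)).
  by move=> ui vi; have := integrableD measurableT ui vi.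
have mi := integrable_maxr fi gi.
rewrite /dnorm2 unlock /norm1 -/(Rintegral _ _ _).
set a := `|x|; set b := `|y|.
have a0 : 0 <= a by exact: normr_ge0.
have b0 : 0 <= b by exact: normr_ge0.
have ab1 k l : \int[mu]_w (k * f w + l * g w) = k + l.
  rewrite RintegralD ?RintegralZl// ?f1 ?g1 ?mulr1//; exact: Zi.
have abi := integrable_maxr (Zi a _ fi) (Zi b _ gi).
apply/eqP; rewrite eq_le; apply/andP; split.
  rewrite -ab1; apply: le_Rintegral => //; first exact: Di (Zi _ _ fi) (Zi _ _ gi).
  by move=> w _; rewrite ge_max lerDl lerDr !mulr_ge0.
(* [min (a f) (b g) <= (a + b) (min f g)], and [min f g] has integral [<= 0] *)
apply: (@le_trans _ _ (\int[mu]_w ((- b * f w + - a * g w)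
    + (a + b) * Num.max (f w) (g w)))).
  rewrite RintegralD//; [|exact: Di (Zi _ _ fi) (Zi _ _ gi)|exact: Zi].
  by rewrite ab1 RintegralZl//; nra.
apply: le_Rintegral => //.
  exact: Di (Di _ _ (Zi _ _ fi) (Zi _ _ gi)) (Zi _ _ mi).
move=> w _; have := f0 w; have := g0 w.
rewrite le_max; case: (leP (f w) (g w)) => fg gw fw; apply/orP.
  by right; nra.
by left; nra.
Qed.


(** * Refining the grids and passing to the limit *)

(** Both ends are within one diameter of [t]. Indices start at [n.+1] because grids are given for
    positive [d] only. *)
Lemma cell_ends_cvg (R : realType) (s : nat -> nat -> R) (t : R) :
  (forall d : nat, (0 < d)%N -> is_grid d (s d)) ->
  diameter d (s d) @[d --> \oo] --> (0 : R) -> t \in `[0, 1] ->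
  s n.+1 (cell n.+1 (s n.+1) t) @[n --> \oo] --> t /\
  s n.+1 (cell n.+1 (s n.+1) t).+1 @[n --> \oo] --> t.
Proof.
move=> hs hdiam t01.
have dS : diameter n.+1 (s n.+1) @[n --> \oo] --> (0 : R).
  by have := hdiam; rewrite -cvg_shiftS.
have lo : t - diameter n.+1 (s n.+1) @[n --> \oo] --> t.
  by rewrite -[t in X in _ --> X]subr0; apply: cvgB => //; exact: cvg_cst.
have hi : t + diameter n.+1 (s n.+1) @[n --> \oo] --> t.
  by rewrite -[t in X in _ --> X]addr0; apply: cvgD => //; exact: cvg_cst.
have near_ends n : s n.+1 (cell n.+1 (s n.+1) t) <= t
      <= s n.+1 (cell n.+1 (s n.+1) t).+1 /\
    s n.+1 (cell n.+1 (s n.+1) t).+1 - s n.+1 (cell n.+1 (s n.+1) t)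
      <= diameter n.+1 (s n.+1).
  have [id it] := cell_bounds (hs _ (ltn0Sn n)) (ltn0Sn n) t01.
  by split; [|exact: cell_le_diameter].
split.
  apply: (squeeze_cvgr _ lo (cvg_cst t)); apply: nearW => n.
  by have [/andP[]] := near_ends n => *; apply/andP; split; lra.
apply: (squeeze_cvgr _ (cvg_cst t) hi); apply: nearW => n.
by have [/andP[]] := near_ends n => *; apply/andP; split; lra.
Qed.

Theorem theorem4p9 (R : realType)
  (dT dT' : measure_display) (T : measurableType dT) (T' : measurableType dT')
  (P : probability T R) (P' : probability T' R)
  (V : R -> T -> R) (Z : R -> T' -> R)
  (hV : sgpp_with_generator P P' V Z)
  (s : nat -> nat -> R)
  (hs : forall d : nat, (0 < d)%N -> is_grid d (s d))
  (hdiam : diameter d (s d) @[d --> \oo] --> (0 : R))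
  (t : R) (ht : t \in `[0, 1])
  (hD : forall d : nat, (0 < d)%N ->
     dnorm2 P' (Z t) (disc_Z P' Z d (s d) t) <> norm1) :
  exists c1 : R, c1 < 0 /\ forall c : R, c1 < c -> c < 0 ->
    let A (d : nat) : set T :=
      [set w | c < V t w /\ c < disc_V P' Z V d (s d) t w] in
    (forall d : nat, (0 < d)%N -> (0 < P (A d))%E) /\
    cond_expectation P (fun w => (V t w - disc_V P' Z V d (s d) t w) ^+ 2) (A d)
      @[d --> \oo] --> (0 : R).
Proof.
have [c0 [c0_gt0 cdf]] := sgpp_cdf3 hV.
have [cV V0 hZ _] := hV; have [_ Z0 _ _] := hZ.
(* The three-point law holds for thresholds down to [- c0]. *)
exists (- c0); split; first by rewrite oppr_lt0.
move=> c c0c c_lt0 A; have hc : - c0 <= c <= 0 by rewrite !ltW.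
pose i d := cell d (s d) t.
have in_cell d : (0 < d)%N -> (i d < d)%N /\ s d (i d) <= t <= s d (i d).+1.
  by move=> d0; exact: cell_bounds (hs _ d0) d0 ht.
have a01 d (d0 : (0 < d)%N) : s d (i d) \in `[0, 1].
  by apply: (grid01 (hs _ d0)); apply: ltnW; case: (in_cell _ d0).
have b01 d (d0 : (0 < d)%N) : s d (i d).+1 \in `[0, 1].
  by apply: (grid01 (hs _ d0)); case: (in_cell _ d0).
have ab d (d0 : (0 < d)%N) : s d (i d) < s d (i d).+1.
  by have [_ _] := hs _ d0; apply; case: (in_cell _ d0).
have tab d (d0 : (0 < d)%N) := (in_cell d d0).2.
pose e n := \int[P']_w oscillation Z (s n.+1 (i n.+1)) (s n.+1 (i n.+1).+1) t w.
have [at_t bt_t] := cell_ends_cvg hs hdiam ht.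
have e0 : e n @[n --> \oo] --> (0 : R).
  by apply: oscillation_Rintegral_cvg0 => // n; [exact: a01|exact: b01].
have PA d (d0 : (0 < d)%N) := sgpp_exceedance_prob hZ cV V0
  (a01 d d0) (b01 d d0) ht (ab d d0) (tab d d0) cdf hc.
have mA d (d0 : (0 < d)%N) : measurable (A d).
  exact: (@exceedance_measurable _ _ _ _ _ P' _ Z cV _ _ _ (a01 d d0) (b01 d d0) ht c).
split.
  move=> d d0; rewrite [X in (_ < X)%E]PA// lte_fin mulr_gt0 ?oppr_gt0//.
  (* A mean maximum of at least 2 would force the 1-norm, against [hD]. *)
  rewrite subr_gt0 ltNge; apply/negP => max2; apply: (hD d d0).
  apply: dnorm2_norm1 => //.
  - by move=> w; exact: Z0.
  - by move=> w; apply: (disc_Z_ge0 hZ) => //; auto.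
  - exact: generator_integrable.
  - by apply: disc_Z_integrable => //; auto.
  - exact: generator_Rintegral.
  - by apply: disc_Z_Rintegral => //; auto.
rewrite -cvg_shiftS.
pose D n w := V t w - disc_V P' Z V n.+1 (s n.+1) t w.
(* Restricting to the event makes the numerator an integral over the whole space, as dominated
   convergence requires. *)
pose f n := (fun w => D n w ^+ 2) \_ (A n.+1).
have num0 : \int[P]_w f n w @[n --> \oo] --> (0 : R).
  apply: (@Rintegral_bounded_cvg0 _ _ _ _ _ (c ^+ 2)) => [n|w|].
  - apply/(measurable_restrictT _ (mA n.+1 isT)).
    apply: measurable_funTS; apply: measurable_funX; apply: measurable_funB.
      by case: cV => mV _; exact: mV.
    exact: (disc_V_measurable cV t (a01 n.+1 isT) (b01 n.+1 isT)).
  - pose o n := oscillation V (s n.+1 (i n.+1)) (s n.+1 (i n.+1).+1) t w.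
    have o0 : o n @[n --> \oo] --> (0 : R).
      by apply: oscillation_cvg0 => // n; [exact: a01|exact: b01].
    (* The bound of [disc_V_near], squared, vanishes in the limit for each fixed path. *)
    have b0 : ((1 + e n) * o n + e n * `|V t w|) ^+ 2 @[n --> \oo] --> (0 : R).
      have -> : (0 : R) = ((1 + 0) * 0 + 0 * `|V t w|) ^+ 2 by ring.
      rewrite expr2; under eq_fun do rewrite expr2.
      by apply: cvgM; apply: cvgD; apply: cvgM => //;
        by [apply: cvgD => //; exact: cvg_cst|exact: cvg_cst].
    apply: (squeeze_cvgr _ (cvg_cst 0) b0); apply: nearW => n.
    rewrite /f patchE; case: ifP => _; last by rewrite lexx sqr_ge0.
    rewrite sqr_ge0 /= -[leLHS]real_normK ?num_real//.
    rewrite lerXn2r ?nnegrE//; last first.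
      by apply: (disc_V_near hZ V0) => //; auto.
    by apply: le_trans (normr_ge0 _) _; apply: (disc_V_near hZ V0) => //; auto.
  - apply: aeW => w n; rewrite /f patchE; case: ifP => [|_]; last first.
      by rewrite normr0 sqr_ge0.
    rewrite inE => -[cV_ cW]; rewrite ger0_norm ?sqr_ge0//.
    by apply: (exceedance_sqr_le hZ V0) => //; auto.
(* The factor is the inverse of [- c / 2], the eventual lower bound for the conditioning
   probability. *)
have bound : (2 / - c) * \int[P]_w f n w @[n --> \oo] --> (0 : R).
  by rewrite -[0 in X in _ --> X](mulr0 (2 / - c)); apply: cvgM => //; exact: cvg_cst.
rewrite (_ : [sequence _]_n =
    fun n => \int[P]_w f n w / fine (P (A n.+1))); last first.
  by apply/funext => n; rewrite -Rintegral_mkcond.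
apply: (squeeze_cvgr _ (cvg_cst 0) bound); near=> n.
(* The mean maximum is at most [1 + e n], so the factor 2 minus this mean exceeds 1/2. *)
have e12 : e n < 1 / 2 by near: n; apply: (cvgr_lt _ e0); lra.
have num_ge0 : 0 <= \int[P]_w f n w.
  apply: Rintegral_ge0 => w _; rewrite /f patchE.
  by case: ifP => // _; exact: sqr_ge0.
have den : - c / 2 <= fine (P (A n.+1)).
  rewrite [X in fine X]PA//= ler_wpM2l ?oppr_ge0 ?(ltW c_lt0)//.
  have := max_disc_Z_Rintegral_le hZ (a01 n.+1 isT) (b01 n.+1 isT) ht
    (ab n.+1 isT) (tab n.+1 isT).
  by rewrite -/(e n); lra.
have c2 : 0 < - c / 2 by rewrite divr_gt0 ?oppr_gt0.
have den_gt0 : 0 < fine (P (A n.+1)) := lt_le_trans c2 den.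
rewrite divr_ge0 ?(ltW den_gt0)//= [leRHS]mulrC ler_wpM2l//.
by rewrite -invf_div lef_pV2 ?posrE.
Unshelve. all: end_near. Qed.
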